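(* Let $X,Y$ be (Hausdorff) topological vector spaces over the same scalar field such that $Y$ is separable, and let $\mathscr{A}$ be a nonempty set of infinite matrices $A=(A_{n,k}: n,k\in\omega)$ of linear operators in $\mathcal{L}(X,Y)$. Let $\mathcal{I}$ be a countably generated ideal on $\omega$ and let $\bm{x}=(x_k)_{k\in\omega}\in \mathrm{dom}(\mathscr{A})$. Then the following are equivalent: (i) there exists $\eta_1\in Y$ such that $\mathcal{I}\text{-}\lim \mathscr{A}\bm{x}=\eta_1$; (ii) for each $B\in\mathscr{B}_{\mathscr{A}}$ there exists $\eta_B\in Y$ such that $\mathcal{I}\text{-}\lim B\bm{x}=\eta_B$; (iii) there exists $\eta_2\in Y$ such that $\mathcal{I}\text{-}\lim B\bm{x}=\eta_2$ for all $B\in\mathscr{B}_{\mathscr{A}}$. In addition, in such case, $\eta_1=\eta_2$.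
   Context: $\omega=\{0,1,2,\ldots\}$. $\mathcal{L}(X,Y)$ is the set of all (not necessarily continuous) linear operators from $X$ into $Y$. Topological vector spaces are assumed Hausdorff. For a matrix $A=(A_{n,k}:n,k\in\omega)$ with entries in $\mathcal{L}(X,Y)$, $\mathrm{dom}(A)$ is the set of sequences $\bm{x}=(x_k)\in X^\omega$ such that the series $\sum_k A_{n,k}x_k$ converges in $Y$ for every $n\in\omega$; for such $\bm{x}$, $A_n\bm{x}:=\sum_k A_{n,k}x_k$ and $A\bm{x}:=(A_n\bm{x}:n\in\omega)$. Put $\mathrm{dom}(\mathscr{A}):=\bigcap_{A\in\mathscr{A}}\mathrm{dom}(A)$. $\mathscr{B}_{\mathscr{A}}$ is the set of all matrices $B=(B_{n,k})$ of operators in $\mathcal{L}(X,Y)$ such that for every $n\in\omega$ there exists $A\in\mathscr{A}$ (depending on $n$) with $B_{n,k}=A_{n,k}$ for all $k\in\omega$. An ideal on $\omega$ is a family $\mathcal{I}$ of subsets of $\omega$ closed under finite unions and subsets; it is always assumed that $\omega\notin\mathcal{I}$ and that $\mathcal{I}$ contains all finite subsets of $\omega$. $\mathcal{I}^\star:=\{\omega\setminus S: S\in\mathcal{I}\}$. $\mathcal{I}$ is countably generated if there is a sequence $(S_n)_{n\in\omega}$ in $\mathcal{I}$ such that for all $S\subseteq\omega$: $S\in\mathcal{I}$ iff $S\subseteq\bigcup_{n\in F}S_n$ for some finite $F\subseteq\omega$. A sequence $(y_n)$ in $Y$ is $\mathcal{I}$-convergent to $\eta$ ($\mathcal{I}\text{-}\lim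 y_n=\eta$) if $\{n\in\omega:y_n\notin U\}\in\mathcal{I}$ for every neighborhood $U$ of $\eta$. $\mathcal{I}\text{-}\lim\mathscr{A}\bm{x}=\eta$ ($\bm{x}$ is uniformly $\mathscr{A}$-summable to $\eta$) means: $\bm{x}\in\mathrm{dom}(\mathscr{A})$ and for each neighborhood $U$ of $\eta$ there exists $S\in\mathcal{I}^\star$ such that $A_n\bm{x}\in U$ for all $n\in S$ and all $A\in\mathscr{A}$. *)

(* Defs.v *)
From HB Require Import structures.
From mathcomp Require Import all_boot all_order all_algebra.
From mathcomp Require Import all_classical all_reals all_analysis.

Set Implicit Arguments.
Unset Strict Implicit.
Unset Printing Implicit Defensive.

Import Order.TTheory GRing.Theory Num.Theory.
Import numFieldNormedType.Exports.

Local Open Scope classical_set_scope.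
Local Open Scope ring_scope.

Definition separable_space (T : topologicalType) : Prop :=
  exists2 D : set T, countable D & dense D.

(* Proper ideals containing all finite sets.  Closure under the empty union
   follows from [ideal_fin], since set0 is finite. *)
Record is_ideal (I : set (set nat)) : Prop := IsIdeal {
  ideal_setU : forall S T, I S -> I T -> I (S `|` T);
  ideal_sub : forall S T, S `<=` T -> I T -> I S;
  ideal_proper : ~ I [set: nat];
  ideal_fin : forall S, finite_set S -> I S }.

Definition dual_filter (I : set (set nat)) : set (set nat) :=
  [set ~` S | S in I].

Definition countably_generated (I : set (set nat)) : Prop :=
  exists S_ : nat -> set nat, (forall n, I (S_ n)) /\
    forall S : set nat, I S <->
      exists F : set nat, finite_set F /\ S `<=` \bigcup_(n in F) S_ n.

Definition ideal_cvg (T : topologicalType) (I : set (set nat))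
    (y : nat -> T) (eta : T) : Prop :=
  forall U : set T, nbhs eta U -> I [set n | ~ U (y n)].

Section operator_matrices.
Context (K : numFieldType) (X Y : topologicalLmodType K).

(* Entries are linear maps, with no continuity assumption. *)
Definition opmatrix := nat -> nat -> {linear X -> Y}.

Definition row_series (A : opmatrix) (x : nat -> X) (n : nat) : nat -> Y :=
  series (fun k => A n k (x k)).

Definition mxdom (A : opmatrix) : set (nat -> X) :=
  [set x | forall n, exists l : Y, row_series A x n @ \oo --> l].

(* [mxapply A x n] is the sum A_n x for x in [mxdom A], and 0 if the series
   diverges.  This is what [limn] unfolds to; [lim] and [cvg] themselves require
   a canonical pointed structure, which topologicalLmodType does not have. *)
Definition mxapply (A : opmatrix) (x : nat -> X) (n : nat) : Y :=
  xget 0 [set l : Y | row_series A x n @ \oo --> l].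

Definition famdom (AA : set opmatrix) : set (nat -> X) :=
  \bigcap_(A in AA) mxdom A.

(* The matrices each of whose rows is the row of the same index of some
   member of AA. *)
Definition row_mixtures (AA : set opmatrix) : set opmatrix :=
  [set B | forall n, exists2 A, AA A & forall k, B n k = A n k].

Definition unif_summable (I : set (set nat)) (AA : set opmatrix)
    (x : nat -> X) (eta : Y) : Prop :=
  famdom AA x /\
  forall U : set Y, nbhs eta U -> exists2 S, dual_filter I S &
    forall n A, S n -> AA A -> U (mxapply A x n).

(* I-lim B x = eta, where the notation presupposes that B x is defined. *)
Definition mx_summable (I : set (set nat)) (B : opmatrix)
    (x : nat -> X) (eta : Y) : Prop :=
  mxdom B x /\ ideal_cvg I (mxapply B x) eta.

End operator_matrices.

(* Main.v *)
(* If the rows violating some neighbourhood U of eta form a set P outside I, then,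
   I being countably generated, there is C inside P such that neither C nor its
   complement lies in I.  The mixture that uses violating rows on C and a fixed
   A0 in AA off C has the same limit eta as A0, since the two agree on a set
   outside I, although it avoids U on C, which is a contradiction. *)
Require Import Defs.
From HB Require Import structures.
From mathcomp Require Import all_boot all_order all_algebra.
From mathcomp Require Import all_classical all_reals all_analysis.

Set Implicit Arguments.
Unset Strict Implicit.
Unset Printing Implicit Defensive.

Import Order.TTheory GRing.Theory Num.Theory.
Import numFieldNormedType.Exports.

Local Open Scope classical_set_scope.
Local Open Scope ring_scope.

(** Diagonalise against the generators: an injective sequence in [P] escapes the finite unions [T m]
    one after another. Its odd-indexed and its even-indexed terms each escape every member of [I],
    so the odd ones can serve as [C]. *)
Lemma countably_generated_split (I : set (set nat)) (P : set nat) :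
  is_ideal I -> countably_generated I -> ~ I P ->
  exists C : set nat, [/\ C `<=` P, ~ I C & ~ I (~` C)].
Proof.
move=> I_ideal [S_ [IS I_cg]] nIP.
pose T m := \bigcup_(i in `I_m.+1) S_ i.
have IT m : I (T m) by apply/I_cg; exists `I_m.+1; split=> //; exact: finite_II.
(* The pair holds a generator index and a lower bound. If no such [n] existed, [P] would be covered
   by [T mN.1] and the finite set of [n <= mN.2], hence lie in [I]. *)
have /choice[f fP] (mN : nat * nat) :
    exists n, [/\ P n, ~ T mN.1 n & (mN.2 < n)%N].
  apply: contrapT => none; apply: nIP.
  apply: (ideal_sub I_ideal (T := T mN.1 `|` `I_mN.2.+1)).
    move=> n Pn; have [le_n|lt_n] := leqP n mN.2; first by right.
    by left; apply: contrapT => nTn; apply: none; exists n.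
  apply: (ideal_setU I_ideal) => //.
  exact: (ideal_fin I_ideal (finite_II _)).
pose s := fix s m := if m is k.+1 then f (m, s k) else f (0, 0)%N.
have sP m : P (s m) /\ ~ T m (s m).
  by case: m => [|m]; [have [] := fP (0, 0)%N | have [] := fP (m.+1, s m)].
have s_inj : injective s.
  have s_incr : {homo s : i j / (i < j)%N}.
    by apply: homo_ltn => [? ? ?|m]; [exact: ltn_trans | have [] := fP (m.+1, s m)].
  move=> i j sij; apply/eqP; rewrite eqn_leq.
  by apply/andP; split; rewrite leqNgt; apply/negP => /s_incr; rewrite sij ltnn.
(* One parity class of indices is unbounded, and this alone keeps [A] from being covered by finitely
   many generators. *)
have large (b : bool) (A : set nat) :
    (forall m, odd m = b -> A (s m)) -> ~ I A.
  move=> sA /I_cg[F [/finite_seqP[t ->] AF]].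
  pose M := (\max_(i <- t) i)%N.
  (* The index [b + M.*2] has parity [b] and is at least [M], so the corresponding [T] contains
     every generator indexed by [F]. *)
  have odd_m : odd (b + M.*2) = b by rewrite oddD odd_double addbF oddb.
  have [_] := sP (b + M.*2)%N; apply.
  have [i /= ti Si] := AF _ (sA _ odd_m).
  exists i => //=; rewrite ltnS.
  have leM : (i <= M)%N by exact: leq_bigmax_seq.
  by rewrite (leq_trans leM)// -addnn addnA leq_addl.
exists (s @` [set m | odd m]); split.
- by move=> _ [m _ <-]; have [] := sP m.
- by apply: (large true) => m om; exists m.
(* Injectivity of [s] keeps the even-indexed terms out of [C]. *)
- by apply: (large false) => m + [k /= ok /s_inj km]; rewrite -km ok.
Qed.

(** With disjoint neighbourhoods of [a] and [b], each index of agreement would be exceptional for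
    one of the two limits, which would put the agreement set in [I]. *)
Lemma ideal_cvg_unique (T : topologicalType) (I : set (set nat))
    (y z : nat -> T) (a b : T) :
  hausdorff_space T -> is_ideal I -> ~ I [set n | y n = z n] ->
  ideal_cvg I y a -> ideal_cvg I z b -> a = b.
Proof.
move=> T_hausdorff I_ideal nI ya zb; apply: T_hausdorff => U V Ua Vb.
apply: contrapT => UV0; apply: nI.
apply: (ideal_sub I_ideal _ (ideal_setU I_ideal (ya _ Ua) (zb _ Vb))).
move=> n /= yz; have [Uy|] := pselect (U (y n)); last by left.
by right=> Vz; apply: UV0; exists (y n); split=> //; rewrite yz.
Qed.

Section row_mixtures.
Context (K : numFieldType) (X Y : topologicalLmodType K).
Implicit Types (A B : opmatrix X Y) (AA : set (opmatrix X Y)) (x : nat -> X).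

Lemma row_series_congr A B x n :
  (forall k, B n k = A n k) -> row_series B x n = row_series A x n.
Proof. by move=> BA; congr series; apply/funext => k; rewrite BA. Qed.

Lemma mxapply_congr A B x n :
  (forall k, B n k = A n k) -> mxapply B x n = mxapply A x n.
Proof. by move=> BA; rewrite /mxapply (row_series_congr _ BA). Qed.

Lemma sub_row_mixtures AA : AA `<=` row_mixtures AA.
Proof. by move=> A AAA n; exists A. Qed.

Lemma mxdom_row_mixtures AA B x :
  famdom AA x -> row_mixtures AA B -> mxdom B x.
Proof.
move=> x_dom mixB n; have [A AAA BA] := mixB n.
by rewrite (row_series_congr _ BA); exact: x_dom.
Qed.

(** The exceptional set in [I] serves all members of [AA] at once, so it does not matter that the
    matrix supplying row [n] of [B] changes with [n]. *)
Lemma unif_summable_row_mixtures I AA x (eta : Y) B : is_ideal I ->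
  unif_summable I AA x eta -> row_mixtures AA B -> mx_summable I B x eta.
Proof.
move=> I_ideal [x_dom unif] mixB; split; first exact: mxdom_row_mixtures mixB.
move=> U /unif[_ [S IS <-] US]; apply: (ideal_sub I_ideal _ IS) => n /= nU.
apply: contrapT => nS; apply: nU; have [A AAA BA] := mixB n.
by rewrite (mxapply_congr _ BA); exact: US.
Qed.

Lemma row_mixtures_unif_summable I AA x :
  hausdorff_space Y -> is_ideal I -> countably_generated I ->
  AA !=set0 -> famdom AA x ->
  (forall B, row_mixtures AA B -> exists eta : Y, mx_summable I B x eta) ->
  exists eta : Y, unif_summable I AA x eta.
Proof.
move=> Y_hausdorff I_ideal I_cg [A0 AA0] x_dom mix_cvg.
(* The only candidate for the uniform limit is the limit along a single member of [AA], itself a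
   mixture. *)
have [eta [_ A0eta]] := mix_cvg _ (sub_row_mixtures AA0).
exists eta; split=> // U Ueta.
pose P := [set n | exists2 A, AA A & ~ U (mxapply A x n)].
suff IP : I P.
  exists (~` P); first by exists P.
  by move=> n A nPn AAA; apply: contrapT => nU; apply: nPn; exists A.
apply: contrapT => /(countably_generated_split I_ideal I_cg)[C [CP nIC nICC]].
(* Off [C], [A0] is only a default value that makes [g] total. *)
have /choice[g gP] (n : nat) :
    exists A, AA A /\ (C n -> ~ U (mxapply A x n)).
  have [/CP[A AAA nUA]|nCn] := pselect (C n); first by exists A.
  by exists A0; split.
pose B : opmatrix X Y := fun n k => if n \in C then g n n k else A0 n k.
have mixB : row_mixtures AA B.
  move=> n; rewrite /B; case: (n \in C); last by exists A0.
  by exists (g n) => //; have [] := gP n.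
have [etaB [_ Beta]] := mix_cvg _ mixB.
have eta_eq : etaB = eta.
  apply: (ideal_cvg_unique Y_hausdorff I_ideal _ Beta A0eta) => Ieq.
  apply: nICC; apply: (ideal_sub I_ideal _ Ieq) => n nCn /=.
  by apply: mxapply_congr => k; rewrite /B memNset.
rewrite eta_eq in Beta.
apply: nIC; apply: (ideal_sub I_ideal _ (Beta _ Ueta)) => n Cn /=.
rewrite (mxapply_congr (A := g n)); first by have [_] := gP n; exact.
by move=> k; rewrite /B mem_set.
Qed.

End row_mixtures.

Theorem theorem1p2 (K : numFieldType) (X Y : topologicalLmodType K)
  (X_hausdorff : hausdorff_space X) (Y_hausdorff : hausdorff_space Y)
  (Y_separable : separable_space Y)
  (AA : set (opmatrix X Y)) (AA_neq0 : AA !=set0)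
  (I : set (set nat)) (I_ideal : is_ideal I) (I_cg : countably_generated I)
  (x : nat -> X) (x_dom : famdom AA x) :
  [/\ (exists eta1 : Y, unif_summable I AA x eta1) <->
      (forall B, row_mixtures AA B -> exists etaB : Y, mx_summable I B x etaB),
      (forall B, row_mixtures AA B -> exists etaB : Y, mx_summable I B x etaB)
      <->
      (exists eta2 : Y, forall B, row_mixtures AA B -> mx_summable I B x eta2)
    & forall eta1 eta2 : Y,
      unif_summable I AA x eta1 ->
      (forall B, row_mixtures AA B -> mx_summable I B x eta2) ->
      eta1 = eta2].
Proof.
have i_iii eta : unif_summable I AA x eta ->
    forall B, row_mixtures AA B -> mx_summable I B x eta.
  by move=> unif B; exact: unif_summable_row_mixtures.
have ii_i := row_mixtures_unif_summable Y_hausdorff I_ideal I_cg AA_neq0 x_dom.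
split.
- by split=> // -[eta /i_iii iii] B /iii; exists eta.
- split=> [/ii_i[eta /i_iii iii]|[eta iii] B /iii]; by exists eta.
- move=> eta1 eta2 /i_iii iii1 iii2; have [A0 /sub_row_mixtures mixA0] := AA_neq0.
  have [_ cvg1] := iii1 _ mixA0; have [_ cvg2] := iii2 _ mixA0.
  (* Both limits belong to the same sequence, so the agreement set is all of [nat], which is not in
     the proper ideal [I]. *)
  apply: (ideal_cvg_unique Y_hausdorff I_ideal _ cvg1 cvg2) => IT.
  by apply: (ideal_proper I_ideal); apply: (ideal_sub I_ideal _ IT) => n.
Qed.
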